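(* Let $\mathfrak{g}$ be a finite-dimensional Lie algebra over an algebraically closed field $k$ of characteristic zero, let $\mathfrak{h} := \mathfrak{g}/(\operatorname{rad}\mathfrak{g})$, and let $\pi\colon \mathfrak{g} \to \mathfrak{h}$ be the quotient homomorphism. For any element $a \in \mathfrak{g}$, the following conditions are equivalent: 1) for each finite-dimensional representation $\rho\colon \mathfrak{g} \to \mathfrak{gl}(V)$ of $\mathfrak{g}$ over $k$, the operator $\rho(a)$ is nilpotent; 2) $a \in [\mathfrak{g},\mathfrak{g}]$ and $\pi(a) \in N_{\mathfrak{h}}$.
   Context: $\operatorname{rad}\mathfrak{g}$ denotes the radical (the largest solvable ideal) of $\mathfrak{g}$, so that $\mathfrak{h} = \mathfrak{g}/(\operatorname{rad}\mathfrak{g})$ is a semisimple Lie algebra. $[\mathfrak{g},\mathfrak{g}]$ denotes the derived algebra of $\mathfrak{g}$. An element $x$ of a semisimple Lie algebra $\mathfrak{h}$ is called nilpotent if the adjoint operator $\operatorname{ad} x\colon \mathfrak{h}\to\mathfrak{h}$, $y\mapsto [x,y]$, is nilpotent; $N_{\mathfrak{h}}$ denotes the set of all nilpotent elements of $\mathfrak{h}$. *)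

(* Defs.v *)
From HB Require Import structures.
From mathcomp Require Import all_boot all_algebra.
From mathcomp Require Import boolp.

Set Implicit Arguments.
Unset Strict Implicit.
Unset Printing Implicit Defensive.

Import GRing.Theory.
Local Open Scope ring_scope.
Local Open Scope quotient_scope.

Reserved Notation "[ 'lie' x , y ]" (at level 0, format "[ 'lie'  x ,  y ]").
Reserved Notation "{ 'liemorphism' g -> h }"
  (at level 0, g at level 98, h at level 99,
   format "{ 'liemorphism'  g  ->  h }").

(* All Lie algebras here are finite-dimensional: the structure extends Vector. *)
HB.mixin Record Vector_isLieAlgebra (k : fieldType) g of Vector k g := {
  lie : g -> g -> g;
  lie_linearl : forall y : g, linear (lie^~ y);
  lie_linearr : forall x : g, linear (lie x);
  liexx : forall x : g, lie x x = 0;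
  lie_jacobi : forall x y z : g,
    lie x (lie y z) + lie y (lie z x) + lie z (lie x y) = 0
}.

#[short(type="lieAlgType")]
HB.structure Definition LieAlgebra (k : fieldType) :=
  {g of Vector_isLieAlgebra k g & Vector k g}.

Notation "[ 'lie' x , y ]" := (lie x y) : ring_scope.

HB.mixin Record isLieMorphism (k : fieldType) (g h : lieAlgType k)
    (f : g -> h) := {
  lie_morph : {morph f : x y / [lie x, y]}
}.

#[short(type="lieMorphism")]
HB.structure Definition LieMorphism (k : fieldType) (g h : lieAlgType k) :=
  {f of @GRing.Linear k g h *:%R f & isLieMorphism k g h f}.

Notation "{ 'liemorphism' g -> h }" := (lieMorphism g%type h%type) : type_scope.

Section LieAlgebraTheory.
Variables (k : fieldType) (g : lieAlgType k).
Implicit Types (x y z : g) (U V W I J : {vspace g}).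

HB.instance Definition _ x :=
  GRing.isLinear.Build k g g *:%R (lie x) (lie_linearr x).

Lemma lieDl x y z : [lie x + y, z] = [lie x, z] + [lie y, z].
Proof. by have := lie_linearl z 1 x y; rewrite !scale1r. Qed.

Lemma lie0l z : [lie 0, z] = 0.
Proof. by apply: (addIr [lie 0, z]); rewrite -lieDl !add0r. Qed.

Lemma lieZl a x z : [lie a *: x, z] = a *: [lie x, z].
Proof. by have := lie_linearl z a x 0; rewrite lie0l !addr0. Qed.

Lemma lieC x y : [lie x, y] = - [lie y, x].
Proof.
apply/eqP; rewrite -addr_eq0; apply/eqP.
by have := liexx (x + y); rewrite lieDl !linearD /= !liexx add0r addr0.
Qed.

Definition ad x : 'End(g) := linfun (lie x).

(* [U, V]: by bilinearity the brackets of basis vectors suffice to span it, see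
   memv_lie and lie_prod_subvP. *)
Definition lie_prod U V : {vspace g} :=
  <<[seq [lie u, v] | u <- vbasis U, v <- vbasis V]>>%VS.

Lemma memv_lie U V x y : x \in U -> y \in V -> [lie x, y] \in lie_prod U V.
Proof.
move=> /coord_vbasis-> /coord_vbasis->.
rewrite linear_sum rpred_sum // => j _; rewrite linearZ rpredZ //=.
elim/big_rec: _ => [|i u _ IH]; first by rewrite lie0l rpred0.
rewrite lieDl lieZl rpredD // rpredZ // memv_span //.
by apply/allpairsP; exists ((vbasis U)`_i, (vbasis V)`_j);
  split=> //; rewrite mem_nth ?size_tuple.
Qed.

Lemma lie_prod_subvP U V W :
  reflect (forall x y, x \in U -> y \in V -> [lie x, y] \in W)
          (lie_prod U V <= W)%VS.
Proof.
apply: (iffP idP) => [/subvP sW x y xU yV|H]; first exact/sW/memv_lie.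
apply/span_subvP => _ /allpairsP[[u v] /= [/vbasis_mem uU /vbasis_mem vV ->]].
exact: H.
Qed.

Definition derived_algebra : {vspace g} := lie_prod fullv fullv.

Definition derived_series U n : {vspace g} := iter n (fun W => lie_prod W W) U.

Definition lie_solvable U : Prop := exists n, derived_series U n = 0%VS.

Definition is_lie_ideal I : bool := (lie_prod fullv I <= I)%VS.

Record lieIdeal := LieIdeal {
  lieIdeal_vspace :> {vspace g};
  lieIdealP : is_lie_ideal lieIdeal_vspace
}.

End LieAlgebraTheory.

Definition nilpotent_operator (k : fieldType) (V : vectType k) (f : 'End(V)) :
  Prop := exists n, forall v, iter n f v = 0.

(* The ad-nilpotent elements; the notion is meant for semisimple h. *)
Definition nilpotent_elements (k : fieldType) (h : lieAlgType k) : h -> Prop :=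
  fun x => nilpotent_operator (ad x).

Fact jacobi_sum (Z : zmodType) (A B C D E F : Z) :
  A - B + (D - C) + (C - E + (B - F)) + (F - D + (E - A)) = 0.
Proof.
rewrite !addrA [LHS](ACl ((1*12)*(2*7)*(3*10)*(4*5)*(6*11)*(8*9))) /=.
by rewrite !subrr !addNr !addr0.
Qed.

Section GL.
Variables (k : fieldType) (V : vectType k).

Definition gl := 'End(V).
HB.instance Definition _ := Vector.on gl.
Implicit Types x y z : gl.

Definition gl_lie x y : gl := (x \o y)%VF - (y \o x)%VF.

Fact gl_linearl y : linear (gl_lie^~ y).
Proof.
move=> a u v; rewrite /gl_lie comp_lfunDl comp_lfunDr.
by rewrite -comp_lfunZl -comp_lfunZr scalerBr opprD addrACA.
Qed.

Fact gl_linearr x : linear (gl_lie x).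
Proof.
move=> a u v; rewrite /gl_lie comp_lfunDl comp_lfunDr.
by rewrite -comp_lfunZl -comp_lfunZr scalerBr opprD addrACA.
Qed.

Fact gl_liexx x : gl_lie x x = 0.
Proof. exact: subrr. Qed.

Fact gl_jacobi x y z :
  gl_lie x (gl_lie y z) + gl_lie y (gl_lie z x) + gl_lie z (gl_lie x y) = 0.
Proof.
rewrite /gl_lie !(comp_lfunDl, comp_lfunDr, comp_lfunNl, comp_lfunNr).
rewrite !comp_lfunA !opprB.
exact: jacobi_sum.
Qed.

HB.instance Definition _ :=
  Vector_isLieAlgebra.Build k gl gl_linearl gl_linearr gl_liexx gl_jacobi.

End GL.

Section LieQuotient.
Variables (k : fieldType) (g : lieAlgType k) (I : lieIdeal g).

Definition lie_quot := Quotient.quot (pred_of_vspace I).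
HB.instance Definition _ := GRing.Zmodule.on lie_quot.

Definition lie_pi (x : g) : lie_quot := \pi_lie_quot x.

Definition lie_repr (x : lie_quot) : g := repr x.

Lemma lie_reprK : cancel lie_repr lie_pi.
Proof. exact: reprK. Qed.

Lemma lie_piP x y : reflect (lie_pi x = lie_pi y) (x - y \in (I : {vspace g})).
Proof.
rewrite -[x - y \in _]/(x - y \in pred_of_vspace I) Quotient.idealrBE.
exact: eqP.
Qed.

Lemma lie_piD : {morph lie_pi : x y / x + y}.
Proof. by move=> x y; rewrite /lie_pi !piE. Qed.

Definition lie_quot_scale (a : k) (x : lie_quot) := lie_pi (a *: lie_repr x).

Lemma lie_piZ a x : lie_pi (a *: x) = lie_quot_scale a (lie_pi x).
Proof.
apply/lie_piP; rewrite -scalerBr rpredZ //.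
by apply/lie_piP; rewrite lie_reprK.
Qed.

Fact lie_quot_scaleA a b x :
  lie_quot_scale a (lie_quot_scale b x) = lie_quot_scale (a * b) x.
Proof. by rewrite -[x]lie_reprK -!lie_piZ scalerA. Qed.

Fact lie_quot_scale1 : left_id 1 lie_quot_scale.
Proof. by move=> x; rewrite -[x]lie_reprK -!lie_piZ scale1r. Qed.

Fact lie_quot_scaleDr : right_distributive lie_quot_scale +%R.
Proof.
move=> a x y; rewrite -[x]lie_reprK -[y]lie_reprK.
by rewrite -lie_piD -!lie_piZ -lie_piD scalerDr.
Qed.

Fact lie_quot_scaleDl x : {morph lie_quot_scale^~ x : a b / a + b}.
Proof.
by move=> a b /=; rewrite -[x]lie_reprK -!lie_piZ -lie_piD scalerDl.
Qed.

HB.instance Definition _ := GRing.Zmodule_isLmodule.Build k lie_quot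
  lie_quot_scaleA lie_quot_scale1 lie_quot_scaleDr lie_quot_scaleDl.

Fact lie_pi_linear : linear lie_pi.
Proof. by move=> a x y; rewrite lie_piD lie_piZ. Qed.

HB.instance Definition _ :=
  GRing.isLinear.Build k g lie_quot *:%R lie_pi lie_pi_linear.

Lemma lie_pi_eq0 x : (lie_pi x == 0) = (x \in (I : {vspace g})).
Proof.
rewrite -(linear0 lie_pi) -{2}(subr0 x).
exact: (sameP eqP (lie_piP x 0)).
Qed.

Fact lie_quot_vect_iso : Vector.axiom (\dim (I^C)%VS) lie_quot.
Proof.
pose p := daddv_pi (I^C)%VS I.
have capIC : (I^C :&: I = 0)%VS by rewrite capvC capv_compl.
have pI x : x \in (I : {vspace g}) -> p x = 0.
  move=> xI; apply/eqP; rewrite -memv0 -capIC memv_cap memv_pi /=.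
  have := daddv_pi_add capIC; rewrite addvC addv_complf => /(_ x (memvf x)) E.
  by rewrite -[p x](addrK (daddv_pi I I^C x)) E rpredB // memv_pi.
have pE x : x - p x \in (I : {vspace g}).
  have := daddv_pi_add capIC; rewrite addvC addv_complf => /(_ x (memvf x)) E.
  by rewrite -{1}E addrC addKr memv_pi.
have pq x : p (lie_repr (lie_pi x)) = p x.
  have dI : lie_repr (lie_pi x) - x \in (I : {vspace g}) by apply/lie_piP/lie_reprK.
  by apply/eqP; rewrite -subr_eq0 -(pI _ dI) linearB.
exists (fun q => \row_i coord (vbasis I^C) i (p (lie_repr q))).
  move=> a x y; apply/rowP => i; rewrite !mxE -[x]lie_reprK -[y]lie_reprK.
  by rewrite -linearP !pq -!linearP.
exists (fun r : 'rV_(\dim I^C) => lie_pi (\sum_i r 0 i *: (vbasis I^C)`_i)).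
  move=> q; rewrite -[RHS]lie_reprK; apply/lie_piP.
  under eq_bigr do rewrite mxE.
  by rewrite -coord_vbasis ?memv_pi // -memvN opprB.
move=> r; apply/rowP => i; rewrite mxE pq.
have sC : \sum_j r 0 j *: (vbasis I^C)`_j \in (I^C)%VS.
  by rewrite rpred_sum // => j _; rewrite rpredZ ?vbasis_mem ?memt_nth.
by rewrite daddv_pi_id // coord_sum_free ?(basis_free (vbasisP _)).
Qed.

HB.instance Definition _ :=
  Lmodule_hasFinDim.Build k lie_quot lie_quot_vect_iso.

Definition lie_quot_lie (x y : lie_quot) : lie_quot :=
  lie_pi [lie lie_repr x, lie_repr y].

Lemma lie_pi_lie x y : lie_pi [lie x, y] = lie_quot_lie (lie_pi x) (lie_pi y).
Proof.
have IP := lie_prod_subvP _ _ _ (lieIdealP I).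
set x' := lie_repr (lie_pi x); set y' := lie_repr (lie_pi y).
have xI : x - x' \in (I : {vspace g}) by apply/lie_piP; rewrite lie_reprK.
have yI : y - y' \in (I : {vspace g}) by apply/lie_piP; rewrite lie_reprK.
apply/lie_piP.
rewrite -(subrK [lie x, y'] [lie x, y]) -addrA -linearB rpredD //.
  exact: IP (memvf _) yI.
rewrite (lieC x) (lieC x') opprK addrC -linearB.
by rewrite -opprB linearN rpredN IP ?memvf.
Qed.

Fact lie_quot_linearr x : linear (lie_quot_lie x).
Proof.
move=> a u v; rewrite -[x]lie_reprK -[u]lie_reprK -[v]lie_reprK.
by rewrite -linearP -!lie_pi_lie -linearP -linearP.
Qed.

Fact lie_quot_linearl y : linear (lie_quot_lie^~ y).
Proof.
move=> a u v /=; rewrite -[y]lie_reprK -[u]lie_reprK -[v]lie_reprK.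
by rewrite -linearP -!lie_pi_lie -linearP lieDl lieZl.
Qed.

Fact lie_quot_liexx x : lie_quot_lie x x = 0.
Proof. by rewrite -[x]lie_reprK -lie_pi_lie liexx linear0. Qed.

Fact lie_quot_jacobi x y z :
  lie_quot_lie x (lie_quot_lie y z) + lie_quot_lie y (lie_quot_lie z x)
    + lie_quot_lie z (lie_quot_lie x y) = 0.
Proof.
rewrite -[x]lie_reprK -[y]lie_reprK -[z]lie_reprK.
by rewrite -!lie_pi_lie -!linearD lie_jacobi linear0.
Qed.

HB.instance Definition _ := Vector_isLieAlgebra.Build k lie_quot
  lie_quot_linearl lie_quot_linearr lie_quot_liexx lie_quot_jacobi.

HB.instance Definition _ :=
  isLieMorphism.Build k g lie_quot lie_pi lie_pi_lie.

End LieQuotient.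

Arguments lie_pi {k g} I.

Section Radical.
Variables (k : fieldType) (g : lieAlgType k).
Implicit Types (U V W I J : {vspace g}).

Definition is_radical I : Prop :=
  [/\ is_lie_ideal I, lie_solvable I &
      forall J, is_lie_ideal J -> lie_solvable J -> (J <= I)%VS].

Lemma is_lie_idealD I J :
  is_lie_ideal I -> is_lie_ideal J -> is_lie_ideal (I + J)%VS.
Proof.
move=> /lie_prod_subvP iI /lie_prod_subvP iJ; apply/lie_prod_subvP => x y xg.
case/memv_addP=> u uI [v vJ ->]; rewrite linearD.
by rewrite memv_add ?iI ?iJ.
Qed.

Lemma lie_solvableD I J : is_lie_ideal I -> is_lie_ideal J ->
  lie_solvable I -> lie_solvable J -> lie_solvable (I + J)%VS.
Proof.
move=> /lie_prod_subvP iI /lie_prod_subvP iJ [m Im] [n Jn].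
have le1 p : (derived_series (I + J) p <= derived_series I p + J)%VS.
  elim: p => [|p IH] //=; apply/lie_prod_subvP => x y.
  move=> /(subvP IH)/memv_addP[u uI [v vJ ->]].
  move=> /(subvP IH)/memv_addP[u' uI' [v' vJ' ->]].
  rewrite lieDl !linearD /= -addrA memv_add ?memv_lie //.
  apply: rpredD; first exact: iJ (memvf _) vJ'.
  by apply: rpredD; rewrite lieC rpredN; exact: iJ (memvf _) vJ.
have le2 p : (derived_series (I + J) (p + m) <= derived_series J p)%VS.
  elim: p => [|p IH] /=; first by have := le1 m; rewrite Im add0v.
  by apply/lie_prod_subvP => x y /(subvP IH) xJ /(subvP IH) yJ; apply: memv_lie.
by exists (n + m)%N; apply/eqP; rewrite -subv0 -Jn.
Qed.

Lemma is_radical_exists : exists I, is_radical I.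
Proof.
pose P n := `[< exists I, [/\ is_lie_ideal I, lie_solvable I & \dim I = n] >].
have P0 : exists n, P n.
  exists 0%N; apply/asboolP; exists 0%VS; split; last by rewrite dimv0.
    apply/lie_prod_subvP => x y _; rewrite memv0 => /eqP->.
    by rewrite linear0 mem0v.
  by exists 0%N.
have Pm n : P n -> (n <= \dim {:g})%N.
  by move=> /asboolP[I [_ _ <-]]; rewrite dimvS ?subvf.
case: (ex_maxnP P0 Pm) => n /asboolP[I [iI sI dI]] maxn.
exists I; split=> // J iJ sJ.
have /maxn : P (\dim (I + J)).
  apply/asboolP; exists (I + J)%VS; split=> //; first exact: is_lie_idealD.
  exact: lie_solvableD.
rewrite -dI => le; have /eqP-> : I == (I + J)%VS by rewrite eqEdim addvSl.
exact: addvSr.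
Qed.

(* Only existence is used here; lie_radP determines the value uniquely. *)
Definition lie_rad_vspace : {vspace g} := projT1 (cid is_radical_exists).

Lemma lie_rad_vspaceP : is_radical lie_rad_vspace.
Proof. exact: projT2 (cid is_radical_exists). Qed.

Definition lie_rad : lieIdeal g :=
  LieIdeal (let: And3 iI _ _ := lie_rad_vspaceP in iI).

Lemma lie_radP : is_radical lie_rad.
Proof. exact: lie_rad_vspaceP. Qed.

End Radical.

Arguments lie_rad {k} g.
Arguments derived_algebra {k} g.

(* Main.v *)
Require Import Defs.
From HB Require Import structures.
From mathcomp Require Import all_boot all_algebra.
From mathcomp Require Import boolp.
Set Implicit Arguments.
Unset Strict Implicit.
Unset Printing Implicit Defensive.
Import GRing.Theory passmx.
Local Open Scope ring_scope.

(** Suppose first that a lies in [g, g] and that ad pi(a) is nilpotent, and let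
    V be a nonzero irreducible representation.  Two facts do the work.

    - If X is an operator on V with ad X locally nilpotent on the image of g,
      then every generalized eigenspace of X is g-stable
      ([mxlie_nilpotent_geigen]), so by irreducibility X has a single
      eigenvalue, and X minus its mean eigenvalue tr X / dim V is nilpotent
      ([irreducible_nilpotent]).
    - The radical acts by scalars ([irreducible_solvable_scalar], a form of
      Lie's theorem, again a consequence of the first fact).

    Now (ad a)^p y lies in the radical for all y and some p, hence acts by a
    scalar and is killed by one more bracket with a: the first fact applies to
    X = a.  As a is in [g, g] it acts with trace 0, so its only eigenvalue is 0
    and it acts nilpotently.  For arbitrary V, induct on the dimension through an
    invariant subspace and its quotient ([mxrep_nilpotent]).

    Conversely, nilpotency of a in the adjoint representation of h, pulled back
    along pi, says that pi(a) is ad-nilpotent; and if a were outside [g, g], a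
    linear form vanishing on [g, g] but not at a would be a one-dimensional
    representation in which a is not nilpotent.

    Representations are handled as families of matrices acting on row vectors,
    where ranks, kernels and traces are at hand. *)

(** * Commutators and nilpotent matrices *)

Section Matrices.
Variable k : fieldType.

Definition mxlie n (A B : 'M[k]_n) := A *m B - B *m A.

Lemma mxlieC n (A B : 'M[k]_n) : mxlie A B = - mxlie B A.
Proof. by rewrite /mxlie opprB. Qed.

Lemma mxlie_subl_scalar n (A B : 'M[k]_n) c : mxlie (A - c%:M) B = mxlie A B.
Proof. by rewrite /mxlie mulmxBl mulmxBr scalar_mxC opprB addrA subrK. Qed.

Lemma mxtrace_mxlie n (A B : 'M[k]_n) : \tr (mxlie A B) = 0.
Proof. by rewrite linearB /= mxtrace_mulC subrr. Qed.

Lemma nilpotent_kernel n (A : 'M[k]_n) (v : 'rV_n) p :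
  v != 0 -> v *m A ^+ p = 0 ->
  exists2 q, v *m A ^+ q != 0 & v *m A ^+ q *m A = 0.
Proof.
elim: p v => [|p IH] v v0.
  by rewrite expr0 mulmx1 => /eqP; rewrite (negPf v0).
rewrite exprS mulmxA; have [vA|vA] := eqVneq (v *m A) 0.
  by exists 0%N; rewrite expr0 mulmx1.
by case/(IH _ vA) => q q1 q2; exists q.+1; rewrite exprS -mulmxE mulmxA.
Qed.

(** Apply to a common kernel vector of the other matrices the last power of A
    that does not kill it: commutation keeps the result in their kernels. *)
Lemma common_kernel n (As : seq 'M[k]_n) :
    (0 < n)%N -> {in As &, forall A B, A *m B = B *m A} ->
    {in As, forall A, exists p, A ^+ p = 0} ->
  exists2 v : 'rV_n, v != 0 & {in As, forall A, v *m A = 0}.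
Proof.
move=> n0; elim: As => [|A As IH] cAs nAs.
  exists (const_mx 1) => //; apply/eqP => /rowP/(_ (Ordinal n0)).
  by rewrite !mxE => /eqP; rewrite oner_eq0.
case: IH => [B C BAs CAs|B BAs|v v0 vAs].
- by apply: cAs; rewrite inE ?BAs ?CAs orbT.
- by apply: nAs; rewrite inE BAs orbT.
have [p Ap] := nAs A (mem_head _ _).
have vAp : v *m A ^+ p = 0 by rewrite Ap mulmx0.
have [q vq vqA] := nilpotent_kernel v0 vAp; exists (v *m A ^+ q) => // B.
rewrite inE => /predU1P[-> //|BAs]; rewrite -mulmxA.
have cAB : GRing.comm A B by apply: cAs; rewrite inE ?eqxx ?BAs ?orbT.
rewrite mulmxE -(commrX q (commr_sym cAB)).
by rewrite -mulmxE mulmxA vAs ?mul0mx.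
Qed.

(** If ad A kills B after m steps, then B maps the generalized kernel of A into
    itself, losing at most m powers of A.  Each commutation B A = A B - [A, B]
    either consumes a power of A on w or lowers m, so induct on p + m. *)
Lemma mxlie_nilpotent_geigen r n (A B : 'M[k]_n) m p (w : 'M_(r, n)) :
  iter m (mxlie A) B = 0 -> w *m A ^+ p = 0 -> w *m B *m A ^+ (p + m) = 0.
Proof.
have [s] := ubnP (p + m); elim: s => // s IH in m p w B *.
rewrite ltnS => le_s Bm wp.
case: m => [|m] in le_s Bm *.
  by rewrite -[B]/(iter 0 (mxlie A) B) Bm mulmx0 mul0mx.
case: p => [|p] in le_s wp *.
  by move: wp; rewrite expr0 mulmx1 => ->; rewrite !mul0mx.
have E : B *m A = A *m B - mxlie A B by rewrite /mxlie opprB addrC subrK.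
have -> : A ^+ (p.+1 + m.+1) = A *m A ^+ (p + m.+1).
  by rewrite addSn exprS -mulmxE.
rewrite mulmxA -(mulmxA w B) E mulmxBr mulmxBl mulmxA IH //; last first.
  by rewrite -mulmxA mulmxE -exprS.
rewrite addnS -addSn IH ?subrr //; first by rewrite addSnnS.
by rewrite -iterSr.
Qed.

End Matrices.

(** All roots of the characteristic polynomial are eigenvalues, hence 0, so it
    is a pure power of 'X. *)
Lemma nilpotent_mxtrace (k : closedFieldType) n (A : 'M[k]_n) p :
  A ^+ p = 0 -> \tr A = 0.
Proof.
move=> Ap; case: (posnP n) => [n0|n0].
  by subst n; rewrite [A]flatmx0 linear0.
have [r Er] := closed_field_poly_normal (char_poly A).
have r0 : {in r, forall z, z = 0}.
  move=> z zr; have : eigenvalue A z.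
    rewrite eigenvalue_root_char Er (monicP (char_poly_monic A)) scale1r.
    by rewrite root_prod_XsubC.
  case/eigenvalueP => v vA v0; have : v *m A ^+ p = z ^+ p *: v.
    elim: (p) => [|q IH]; first by rewrite expr0 mulmx1 scale1r.
    by rewrite exprSr -mulmxE mulmxA IH -scalemxAl vA scalerA exprSr.
  rewrite Ap mulmx0 => /esym/eqP.
  by rewrite scaler_eq0 (negPf v0) orbF expf_eq0 => /andP[_ /eqP].
move: Er; rewrite (monicP (char_poly_monic A)) scale1r.
rewrite (eq_big_seq (fun _ => 'X)) => [|z /r0->]; last by rewrite subr0.
rewrite big_const_seq count_predT iter_mulr_1 => Er.
have := size_char_poly A; rewrite Er size_polyXn => -[rn].
have := char_poly_trace A n0; rewrite Er rn coefXn.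
by rewrite ltn_eqF ?prednK // => /esym/eqP; rewrite oppr_eq0 => /eqP.
Qed.

(** * Ideals and matrix representations *)

Section MatrixRepresentations.
Variables (k : fieldType) (g : lieAlgType k).

Lemma is_lie_ideal_prod (I J : {vspace g}) :
  is_lie_ideal I -> is_lie_ideal J -> is_lie_ideal (lie_prod I J).
Proof.
move=> /lie_prod_subvP iI /lie_prod_subvP iJ; apply/lie_prod_subvP => x y _.
suff /subvP sIJ : (lie_prod I J <= ad x @^-1: lie_prod I J)%VS.
  by move=> /sIJ; rewrite -memv_preim lfunE.
apply/lie_prod_subvP => u v uI vJ; rewrite -memv_preim lfunE /=.
have := lie_jacobi x u v; rewrite -addrA => /eqP; rewrite addr_eq0 => /eqP->.
rewrite rpredN rpredD //; first by rewrite memv_lie // lieC rpredN iJ ?memvf.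
by rewrite lieC rpredN memv_lie // iI ?memvf.
Qed.

Definition is_mxrep n (M : g -> 'M[k]_n) :=
  forall x y, M [lie x, y] = mxlie (M x) (M y).

Definition mxirreducible n (M : g -> 'M[k]_n) :=
  forall U : 'M_n, (forall x, stablemx U (M x)) -> U != 0 -> row_full U.

(** Commutators have trace 0; the set where a linear form vanishes being a
    subspace, this extends to the span of the brackets. *)
Lemma mxrep_trace_prod n (M : {linear g -> 'M[k]_n}) (U V : {vspace g}) x :
  is_mxrep M -> x \in lie_prod U V -> \tr (M x) = 0.
Proof.
move=> repM; pose t : {linear g -> k^o} := (@mxtrace k n) \o M.
suff /subvP sP : (lie_prod U V <= lker (linfun t))%VS.
  by move=> /sP; rewrite memv_ker lfunE => /eqP.
apply/lie_prod_subvP => u v _ _.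
by rewrite memv_ker lfunE /= repM mxtrace_mxlie.
Qed.

Lemma mxrep_iter n (M : g -> 'M[k]_n) m x y :
  is_mxrep M -> M (iter m (lie x) y) = iter m (mxlie (M x)) (M y).
Proof. by move=> repM; elim: m => //= m <-. Qed.

End MatrixRepresentations.

(** * Irreducible representations *)

Section Irreducible.
Variables (k : closedFieldType) (g : lieAlgType k) (n : nat).
Hypotheses (k_char0 : [pchar k] =i pred0) (n_gt0 : (0 < n)%N).

(** The average of the eigenvalues: it is linear in A, and in characteristic 0 it
    is the eigenvalue when there is only one. *)
Definition mean_eigenvalue (A : 'M[k]_n) : k := n%:R^-1 * \tr A.

Definition traceless_part (A : 'M[k]_n) := A - (mean_eigenvalue A)%:M.

Let n_neq0 : n%:R != 0 :> k.
Proof. by rewrite (pcharf0P k).1 // -lt0n. Qed.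

Lemma traceless_part_is_linear : linear traceless_part.
Proof.
move=> c A B; rewrite /traceless_part /mean_eigenvalue linearP /= mulrDr mulrCA.
by rewrite raddfD /= scalerBr scale_scalar_mx opprD addrACA.
Qed.
HB.instance Definition _ := GRing.isLinear.Build k 'M[k]_n 'M[k]_n *:%R
  traceless_part traceless_part_is_linear.

Lemma traceless_part_id A : \tr A = 0 -> traceless_part A = A.
Proof.
by rewrite /traceless_part /mean_eigenvalue => ->; rewrite mulr0 raddf0 subr0.
Qed.

(** A generalized eigenspace of X is nonzero and invariant, hence everything. *)
Lemma irreducible_nilpotent (M : g -> 'M[k]_n) X : mxirreducible M ->
    (forall y, exists m, iter m (mxlie X) (M y) = 0) ->
  exists p, traceless_part X ^+ p = 0.
Proof.
move=> irrM nilX.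
have [mu muX] : exists mu, eigenvalue X mu.
  have /closed_rootP[mu] : size (char_poly X) != 1%N.
    by rewrite size_char_poly eqSS -lt0n.
  by exists mu; rewrite eigenvalue_root_char.
pose Z := X - mu%:M.
(* The generalized eigenspace is the largest among the kernels of powers of Z,
   so that further powers of Z do not enlarge it. *)
pose P (r : nat) := `[< exists p, \rank (kermx (Z ^+ p)) = r >].
have P1 : P (\rank (kermx Z)) by apply/asboolP; exists 1%N; rewrite expr1.
have Pn r : P r -> (r <= n)%N by case/asboolP => p <-; apply: rank_leq_row.
have exP : exists r, P r by exists (\rank (kermx Z)).
case: (ex_maxnP exP Pn) => r /asboolP[p rp] max_r.
have full : row_full (kermx (Z ^+ p)).
  apply: irrM => [y|].
    have [m Zm] : exists m, iter m (mxlie Z) (M y) = 0.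
      have [m Xm] := nilX y; exists m; rewrite -Xm.
      by apply: eq_iter => B; apply: mxlie_subl_scalar.
    have /(mxlie_nilpotent_geigen Zm)/sub_kermxP s1 := mulmx_ker (Z ^+ p).
    apply: submx_trans s1 _.
    have s2 : (kermx (Z ^+ p) <= kermx (Z ^+ (p + m)))%MS.
      by apply/sub_kermxP; rewrite exprD -mulmxE mulmxA mulmx_ker mul0mx.
    rewrite -(mxrank_leqif_sup s2) eqn_leq mxrankS //= rp max_r //.
    by apply/asboolP; exists (p + m)%N.
  rewrite -mxrank_eq0 -lt0n rp (leq_trans _ (max_r _ P1)) //.
  by rewrite lt0n mxrank_eq0.
have Zp : Z ^+ p = 0.
  by have /sub_kermxP := submx_full 1%:M full; rewrite mul1mx.
exists p; have := nilpotent_mxtrace Zp.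
rewrite /traceless_part /mean_eigenvalue linearB /= mxtrace_scalar => /eqP.
by rewrite subr_eq0 => /eqP->; rewrite -[mu *+ n]mulr_natl mulKf ?n_neq0.
Qed.

(** Induct on the derived length of I.  By induction [I, I] acts by scalars,
    of trace 0, that is by 0; so the operators of I commute with one another and
    each is killed by the square of ad X for X in I.  Their traceless parts are
    therefore nilpotent and commuting, and have a common kernel W <> 0.  On W the
    brackets [y, x] with x in I act by 0, being their own traceless parts; so for
    w in W, y carries w to a vector still killed by the traceless part of x.
    Thus W is g-stable, hence everything. *)
Lemma irreducible_solvable_scalar (M : {linear g -> 'M[k]_n}) (I : {vspace g}) :
    is_mxrep M -> mxirreducible M -> is_lie_ideal I -> lie_solvable I ->
  {in I, forall x, traceless_part (M x) = 0}.
Proof.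
move=> repM irrM iI [m]; elim: m I iI => [|m IH] I iI.
  by move=> /= -> x; rewrite memv0 => /eqP->; rewrite !linear0.
rewrite /derived_series iterSr => Im.
have {}IH : {in lie_prod I I, forall x, M x = 0}.
  move=> x xI; rewrite -(traceless_part_id (mxrep_trace_prod repM xI)).
  exact: IH (is_lie_ideal_prod iI iI) Im _ xI.
have /lie_prod_subvP lieI := iI.
have comM : {in I &, forall x y, M x *m M y = M y *m M x}.
  move=> x y xI yI; apply/eqP; rewrite -subr_eq0 -[_ - _]repM.
  by rewrite IH ?memv_lie.
have nilM : {in I, forall x, exists p, traceless_part (M x) ^+ p = 0}.
  move=> x xI; apply: irreducible_nilpotent irrM _ => y; exists 2%N.
  rewrite -mxrep_iter //= IH // memv_lie // lieC rpredN lieI //.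
  exact: memvf.
pose Ns := [seq traceless_part (M x) | x <- vbasis I].
have [||v v0 vK] := @common_kernel _ _ Ns n_gt0.
- move=> _ _ /mapP[x /vbasis_mem xI ->] /mapP[y /vbasis_mem yI ->].
  apply: comm_mxB; last exact: comm_mx_scalar.
  apply/comm_mx_sym/comm_mxB; last exact: comm_mx_scalar.
  exact: comM.
- by move=> _ /mapP[x /vbasis_mem xI ->]; apply: nilM.
pose W := (\bigcap_(i < \dim I) kermx (traceless_part (M (vbasis I)`_i)))%MS.
have WP r (w : 'M_(r, n)) :
    reflect {in I, forall x, w *m traceless_part (M x) = 0} (w <= W)%MS.
  apply: (iffP sub_bigcapmxP) => wK.
    move=> x /coord_vbasis->; rewrite !linear_sum /= big1 // => i _.
    rewrite !linearZ /=; have /sub_kermxP-> := wK i isT.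
    by rewrite scaler0.
  by move=> i _; apply/sub_kermxP/wK/vbasis_mem; rewrite mem_nth ?size_tuple.
have Wfull : row_full W.
  apply: irrM => [y|]; last first.
    apply: contraNneq v0 => W0; rewrite -submx0 -W0; apply/sub_bigcapmxP => i _.
    by apply/sub_kermxP/vK/map_f; rewrite mem_nth ?size_tuple.
  apply/WP => x xI; have /WP WK := submx_refl W.
  have yxI : [lie y, x] \in I by rewrite lieI ?memvf.
  have tr0 : \tr (M [lie y, x]) = 0 by rewrite repM mxtrace_mxlie.
  have := WK _ yxI; rewrite (traceless_part_id tr0) repM mxlieC.
  rewrite -(mxlie_subl_scalar _ _ (mean_eigenvalue (M x))) mulmxN mulmxBr.
  by rewrite !mulmxA WK // mul0mx sub0r opprK.
by move=> x xI; have /WP/(_ x xI) := submx_full 1%:M Wfull; rewrite mul1mx.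
Qed.

End Irreducible.

(** * Invariant subspaces and quotients *)

Section InvariantSubspaces.
Variables (k : fieldType) (g : lieAlgType k) (n : nat).
Variable M : {linear g -> 'M[k]_n}.
Hypothesis repM : is_mxrep M.

(** The common shape of subrepresentations and quotients: on row vectors, L
    lifts the smaller space into the larger one and R maps back. *)
Definition mxcompress r (L : 'M[k]_(r, n)) (R : 'M[k]_(n, r)) :
  {linear g -> 'M[k]_r} := mulmxr R \o (mulmx L \o M).

Lemma mxcompress_rep r (L : 'M[k]_(r, n)) (R : 'M[k]_(n, r)) :
    (forall x y, L *m M x *m (R *m L) *m M y *m R = L *m M x *m M y *m R) ->
  is_mxrep (mxcompress L R).
Proof.
move=> LR x y; rewrite /= repM /mxlie mulmxBr mulmxBl !mulmxA.
by rewrite -!LR !mulmxA.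
Qed.

Variable U : 'M[k]_n.
Hypothesis stabU : forall x, stablemx U (M x).

Definition mxsubrep := mxcompress (row_base U) (pinvmx (row_base U)).

(** The columns of [col_base (cokermx U)] form a basis of the linear forms
    vanishing on U: they are coordinates on the quotient by U. *)
Definition mxquorep :=
  mxcompress (pinvmx (col_base (cokermx U))) (col_base (cokermx U)).

Lemma mxsubrepE x : mxsubrep x *m row_base U = row_base U *m M x.
Proof. by rewrite /= mulmxKpV // -/(stablemx _ _) stablemx_row_base. Qed.

Lemma mxquorepE x :
  col_base (cokermx U) *m mxquorep x = M x *m col_base (cokermx U).
Proof.
set P := col_base _; have kerP r (A : 'M_(r, n)) : (A <= U)%MS = (A *m P == 0).
  rewrite submxE -{1}(mulmx_base (cokermx U)) -/P mulmxA.
  by rewrite mulmx_free_eq0 // row_base_free.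
have PS : (P *m pinvmx P - 1%:M <= U)%MS.
  by rewrite kerP mulmxBl -mulmxA mulVpmx ?col_base_full // mulmx1 mul1mx subrr.
have := submx_trans (submxMr (M x) PS) (stabU x).
by rewrite kerP !mulmxBl mul1mx subr_eq0 => /eqP <-; rewrite /= !mulmxA.
Qed.

Lemma mxsubrep_rep : is_mxrep mxsubrep.
Proof.
apply: mxcompress_rep => x y; congr (_ *m _ *m _).
by have /= := mxsubrepE x; rewrite !mulmxA.
Qed.

Lemma mxquorep_rep : is_mxrep mxquorep.
Proof.
apply: mxcompress_rep => x y; have /= := mxquorepE y; rewrite -!mulmxA => E.
by rewrite -[in RHS]E !mulmxA.
Qed.

(** M a ^+ q sends everything into U, which M a ^+ p kills. *)
Lemma mxrep_nilpotent_split a :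
    (exists p, mxsubrep a ^+ p = 0) -> (exists q, mxquorep a ^+ q = 0) ->
  exists p, M a ^+ p = 0.
Proof.
move=> [p sub_p] [q quo_q]; exists (q + p).
have subE : row_base U *m M a ^+ p = 0.
  suff <- : mxsubrep a ^+ p *m row_base U = row_base U *m M a ^+ p.
    by rewrite sub_p mul0mx.
  elim: (p) => [|m IH]; first by rewrite !expr0 mul1mx mulmx1.
  by rewrite exprS -mulmxE -mulmxA IH mulmxA mxsubrepE exprS -mulmxE mulmxA.
have quoE : M a ^+ q *m col_base (cokermx U) = 0.
  suff <- : col_base (cokermx U) *m mxquorep a ^+ q
            = M a ^+ q *m col_base (cokermx U) by rewrite quo_q mulmx0.
  elim: (q) => [|m IH]; first by rewrite !expr0 mul1mx mulmx1.
  by rewrite exprSr -mulmxE mulmxA IH -mulmxA mxquorepE mulmxA exprSr.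
have : (M a ^+ q <= row_base U)%MS.
  by rewrite eq_row_base submxE -[cokermx U]mulmx_base mulmxA quoE mul0mx.
by case/submxP => D E; rewrite exprD -mulmxE E -mulmxA subE mulmx0.
Qed.

End InvariantSubspaces.

(** * Nilpotency in every representation *)

Section MatrixOfRepresentation.
Variables (k : fieldType) (g : lieAlgType k).
Variables (V : vectType k) (rho : {liemorphism g -> gl V}).
Let e := vbasis {:V}.
Let e_basis : basis_of {:V} e := vbasisP _.

(** Operators compose in the opposite order to their matrices on row vectors, so
    brackets change sign; negating the matrices restores the sign. *)
Definition rep_mx (x : g) : 'M[k]_(\dim {:V}) := - mxof e e (rho x).

Lemma rep_mx_is_linear : linear rep_mx.
Proof.
by move=> c x y; rewrite /rep_mx linearP mxof_linear opprD scalerN.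
Qed.
HB.instance Definition _ := GRing.isLinear.Build k g 'M[k]_(\dim {:V}) *:%R
  rep_mx rep_mx_is_linear.

Lemma rep_mx_rep : is_mxrep rep_mx.
Proof.
move=> x y; rewrite /rep_mx lie_morph.
have -> : mxof e e [lie rho x, rho y] =
    mxof e e (rho x \o rho y)%VF - mxof e e (rho y \o rho x)%VF.
  exact: linearB.
rewrite !(mxof_comp _ _ e_basis).
by rewrite /mxlie !mulmxN !mulNmx !opprK opprB.
Qed.

Lemma rep_mx_nilpotent x p : rep_mx x ^+ p = 0 -> nilpotent_operator (rho x).
Proof.
move=> xp; exists p => v.
apply: (can_inj (rVofK e_basis)); rewrite linear0.
have -> : rVof e (iter p (rho x) v)
          = (-1) ^+ p *: (rVof e v *m rep_mx x ^+ p).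
  elim: (p) => [|q IH] /=; first by rewrite !expr0 scale1r mulmx1.
  rewrite (rVof_app _ e_basis) IH -scalemxAl [rep_mx x ^+ q.+1]exprSr -mulmxE.
  rewrite exprS mulN1r scaleNr.
  by rewrite mulmxN mulmxN scalerN opprK mulmxA.
by rewrite xp mulmx0 scaler0.
Qed.

End MatrixOfRepresentation.

Section NilpotentAction.
Variables (k : closedFieldType) (g : lieAlgType k).
Hypothesis k_char0 : [pchar k] =i pred0.

(** When M is irreducible, some (ad a)^p y acts by a scalar, so one more bracket
    with a kills it and M a is nilpotent up to its mean eigenvalue, which is 0
    because a is a sum of brackets.  Otherwise nilpotency is inherited from an
    invariant subspace and its quotient. *)
Lemma mxrep_nilpotent n (M : {linear g -> 'M[k]_n}) a :
    is_mxrep M -> a \in derived_algebra g ->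
    (forall y, exists p, iter p (lie a) y \in (lie_rad g : {vspace g})) ->
  exists p, M a ^+ p = 0.
Proof.
have [m] := ubnP n; elim: m => // m IH in n M *; rewrite ltnS => le_nm.
move=> repM aD arad; have [n0|n_gt0] := posnP n.
  by exists 0%N; subst n; apply: flatmx0.
have [irrM|] := pselect (mxirreducible M).
  have [radI radS _] := lie_radP g.
  rewrite -(traceless_part_id (mxrep_trace_prod repM aD)).
  apply: (irreducible_nilpotent k_char0 n_gt0 irrM) => y.
  have [p yp] := arad y; exists p.+1; rewrite -mxrep_iter // iterS repM.
  have /eqP := irreducible_solvable_scalar k_char0 n_gt0 repM irrM radI radS yp.
  by rewrite subr_eq0 => /eqP->; rewrite /mxlie scalar_mxC subrr.
move=> /existsNP[U /not_implyP[stabU /not_implyP[U0 Unfull]]].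
have ltUn : (\rank U < n)%N.
  by rewrite ltn_neqAle rank_leq_row andbT; apply/negP.
apply: (mxrep_nilpotent_split stabU); apply: IH => //.
- exact: leq_trans le_nm.
- exact: mxsubrep_rep.
- apply: leq_trans le_nm; rewrite mxrank_coker.
  by rewrite -subn_gt0 subKn ?rank_leq_row // lt0n mxrank_eq0.
- exact: mxquorep_rep.
Qed.

Lemma rep_nilpotent (V : vectType k) (rho : {liemorphism g -> gl V}) a :
    a \in derived_algebra g ->
    (forall y, exists p, iter p (lie a) y \in (lie_rad g : {vspace g})) ->
  nilpotent_operator (rho a).
Proof.
move=> aD arad; have [p] := mxrep_nilpotent (rep_mx_rep rho) aD arad.
exact: rep_mx_nilpotent.
Qed.

End NilpotentAction.

(** * Adjoint representation and characters *)

Section TestRepresentations.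
Variable k : fieldType.

Section Adjoint.
Variable g : lieAlgType k.

Lemma ad_is_linear : linear (@ad k g : g -> gl g).
Proof.
move=> c x y; apply/lfunP => z.
by rewrite add_lfunE scale_lfunE !lfunE /= lieDl lieZl.
Qed.

Lemma ad_morph : {morph (@ad k g : g -> gl g) : x y / [lie x, y]}.
Proof.
move=> x y; apply/lfunP => z.
rewrite add_lfunE opp_lfunE !comp_lfunE !lfunE /=.
have /eqP := lie_jacobi x y z; rewrite addrC addr_eq0 => /eqP E.
by rewrite lieC E opprK (lieC z) linearN.
Qed.

HB.instance Definition _ := GRing.isLinear.Build k g (gl g) *:%R
  (@ad k g : g -> gl g) ad_is_linear.
HB.instance Definition _ := isLieMorphism.Build k g (gl g)
  (@ad k g : g -> gl g) ad_morph.

End Adjoint.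

Section Composition.
Variables (g1 g2 g3 : lieAlgType k).
Variables (f : {liemorphism g2 -> g3}) (h : {liemorphism g1 -> g2}).

Lemma comp_lie_morph : {morph f \o h : x y / [lie x, y]}.
Proof. by move=> x y; rewrite /= !lie_morph. Qed.
HB.instance Definition _ := isLieMorphism.Build k g1 g3 (f \o h) comp_lie_morph.

End Composition.

(** The projection of a onto a complement of U along U is nonzero, and so is one
    of its coordinates. *)
Lemma separating_form (V : vectType k) (U : {vspace V}) a : a \notin U ->
  exists2 t : {linear V -> k^o}, t a != 0 & {in U, forall u, t u = 0}.
Proof.
move=> aU; pose p := daddv_pi (U^C)%VS U.
have capUC : (U^C :&: U = 0)%VS by rewrite capvC capv_compl.
have pE x : p x + daddv_pi U U^C x = x.
  by apply: (daddv_pi_add capUC); rewrite addvC addv_complf memvf.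
have pU u : u \in U -> p u = 0.
  move=> uU; apply/eqP; rewrite -memv0 -capUC memv_cap memv_pi /=.
  by rewrite -[p u](addrK (daddv_pi U U^C u)) pE rpredB // memv_pi.
have [i ai] : exists i, coord (vbasis U^C) i (p a) != 0.
  apply/existsP; apply: contraR aU => /existsPn p0.
  rewrite -(pE a) (coord_vbasis (memv_pi U^C U a)) big1 => [|i _].
    by rewrite add0r memv_pi.
  by have /negPn/eqP-> := p0 i; rewrite scale0r.
by exists (coord (vbasis U^C) i \o p) => // u /pU /= ->; rewrite linear0.
Qed.

Section Character.
Variables (g : lieAlgType k) (t : {linear g -> k^o}).
Hypothesis tP : forall x y, t [lie x, y] = 0.

Definition lie_character (x : g) : gl k^o := t x *: \1%VF.

Lemma lie_character_is_linear : linear lie_character.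
Proof. by move=> c x y; rewrite /lie_character linearP scalerDl scalerA. Qed.
HB.instance Definition _ := GRing.isLinear.Build k g (gl k^o) *:%R
  lie_character lie_character_is_linear.

Lemma lie_character_morph : {morph lie_character : x y / [lie x, y]}.
Proof.
move=> x y; rewrite /lie_character tP scale0r; apply/esym/eqP.
rewrite subr_eq0 -!comp_lfunZl -!comp_lfunZr; apply/eqP.
by rewrite !scalerA mulrC.
Qed.

Lemma lie_character_exists : exists rho : {liemorphism g -> gl k^o},
  forall x v, rho x v = t x * v.
Proof.
pose m := isLieMorphism.Build k g (gl k^o) _ lie_character_morph.
pose rho : {liemorphism g -> gl k^o} := HB.pack lie_character m.
by exists rho => x v; rewrite /= /lie_character scale_lfunE id_lfunE.
Qed.

End Character.
End TestRepresentations.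

Theorem theorem1 (k : closedFieldType) (k_char0 : [pchar k] =i pred0)
    (g : lieAlgType k) (a : g) :
  (forall (V : vectType k) (rho : {liemorphism g -> gl V}),
      nilpotent_operator (rho a))
  <->
  (a \in derived_algebra g /\
   nilpotent_elements (lie_pi (lie_rad g) a)).
Proof.
split=> [nil_a|[aD [p nil_pa]]]; last first.
  move=> V rho; apply: (rep_nilpotent k_char0 rho aD) => y; exists p.
  rewrite -lie_pi_eq0 -[X in _ == X](nil_pa (lie_pi _ y)); apply/eqP.
  by elim: (p) => //= q <-; rewrite lie_morph lfunE.
split; last first.
  exact: nil_a (@ad k (lie_quot (lie_rad g)) \o lie_pi (lie_rad g)).
apply: contrapT => /negP/separating_form[t ta tD].
have [x y|rho rhoE] := lie_character_exists (t := t).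
  by apply: tD; apply: memv_lie; apply: memvf.
have [p ap] := nil_a k^o rho.
have : iter p (rho a) 1 = t a ^+ p.
  by elim: (p) => //= q IH; rewrite rhoE IH exprS.
by rewrite ap => /esym/eqP; rewrite expf_eq0 (negPf ta) andbF.
Qed.
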